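(* Let $R$ be an integral domain which is not a field, let $D$ denote the set of all nonzero elements of $R$, and let $M$ be a left torsion-free $R$-module. If $M$ contains $D^{-1}R$ as its submodule (that is, $M$ has an $R$-submodule isomorphic to the $R$-module $D^{-1}R$), then the $R$-module $M$ has a proper essential submodule.
   Context: A proper essential submodule of a module $M$ is a submodule $E$ of $M$ with $E\neq\{0_M\}$, $E\neq M$, such that $E\cap N\neq\{0_M\}$ for every nonzero submodule $N$ of $M$. $D^{-1}R$ is the field of fractions of $R$, regarded as an $R$-module. $M$ is torsion-free if $rm=0$ with $r\in R$, $m\in M$ implies $r=0$ or $m=0$. *)

(* Defs.v *)
From HB Require Import structures.
From mathcomp Require Import all_boot all_order all_algebra.
From mathcomp Require Import boolp classical_sets functions.

Set Implicit Arguments.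
Unset Strict Implicit.
Unset Printing Implicit Defensive.

Import GRing.Theory.
Local Open Scope classical_set_scope.
Local Open Scope ring_scope.

(* The library gives [{fraction R}] only its field structure; this copy of the
   type carries the R-module structure a *: x = (a / 1) * x. *)
Definition fracmod (R : idomainType) : Type := {fraction R}.

Section FracModule.
Variable R : idomainType.

HB.instance Definition _ := GRing.Zmodule.copy (fracmod R) {fraction R}.

Definition fracmod_scale (a : R) (x : fracmod R) : fracmod R :=
  (FracField.tofrac a : {fraction R}) * (x : {fraction R}).

Fact fracmod_scaleA (a b : R) (x : fracmod R) :
  fracmod_scale a (fracmod_scale b x) = fracmod_scale (a * b) x.
Proof. by rewrite /fracmod_scale rmorphM mulrA. Qed.

Fact fracmod_scale1 : left_id 1 fracmod_scale.
Proof. by move=> x; rewrite /fracmod_scale rmorph1 mul1r. Qed.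

Fact fracmod_scaleDr : right_distributive fracmod_scale +%R.
Proof. by move=> a x y; apply: (@mulrDr {fraction R}). Qed.

Fact fracmod_scaleDl (x : fracmod R) :
  {morph fracmod_scale^~ x : a b / a + b}.
Proof. by move=> a b; rewrite /fracmod_scale rmorphD; apply: mulrDl. Qed.

HB.instance Definition _ := GRing.Zmodule_isLmodule.Build R (fracmod R)
  fracmod_scaleA fracmod_scale1 fracmod_scaleDr fracmod_scaleDl.

End FracModule.

Section Modules.
Variables (R : idomainType) (M : lmodType R).

(* Submodules are arbitrary classical subsets; membership [x \in N] is made
   boolean by [asbool]. *)
Definition submodule (N : set M) : Prop := submod_closed [in N].

Definition torsion_free : Prop :=
  forall (r : R) (m : M), r *: m = 0 -> r = 0 \/ m = 0.

Definition essential (E : set M) : Prop :=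
  forall N : set M, submodule N -> N <> [set 0] -> E `&` N <> [set 0].

Definition proper_essential_submodule (E : set M) : Prop :=
  [/\ submodule E, E <> [set 0], E <> [set: M] & essential E].

Definition contains_fraction_field : Prop :=
  exists2 N : set M, submodule N &
    exists f : {linear fracmod R -> M}, set_bij [set: fracmod R] N f.

End Modules.

Arguments torsion_free {R} M.
Arguments contains_fraction_field {R} M.

(* Main.v *)
Require Import Defs.
From mathcomp Require Import all_boot all_order all_algebra.
From mathcomp Require Import boolp classical_sets functions.

(** A nonzero nonunit [r] yields [x = f (1 / r)] with [r x = f 1] in [R f(1)] but
    [x] outside [R f(1)].  Zorn gives a submodule [E] containing [R f(1)] and
    maximal among those avoiding [x].  If [E] met a nonzero submodule [N]
    trivially, then [N] would not lie in [E], so by maximality [x = e + n] in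
    [E + N]; hence [r n = r x - r e] lies in [E] and [N], so [n = 0] by
    torsion-freeness and [x = e] lies in [E], a contradiction. *)

Set Implicit Arguments.
Unset Strict Implicit.
Unset Printing Implicit Defensive.

Import GRing.Theory.
Local Open Scope classical_set_scope.
Local Open Scope ring_scope.

Section Submodules.
Variables (R : idomainType) (M : lmodType R).
Implicit Types (E N : set M) (x y : M).

Lemma submoduleP N :
  submodule N <->
  N 0 /\ forall (a : R) x y, N x -> N y -> N (a *: x + y).
Proof.
split=> [[N0 Nlin]|[N0 Nlin]]; split.
- exact: set_mem N0.
- by move=> a x y /mem_set Nx /mem_set Ny; exact: set_mem (Nlin a x y Nx Ny).
- exact: mem_set.
- by move=> a x y /set_mem Nx /set_mem Ny; apply: mem_set; exact: Nlin.
Qed.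

Lemma submoduleD N x y : submodule N -> N x -> N y -> N (x + y).
Proof.
by move=> /submoduleP[_ Nlin] Nx Ny; rewrite -[x]scale1r; exact: Nlin.
Qed.

Lemma submoduleZ N (a : R) x : submodule N -> N x -> N (a *: x).
Proof.
by move=> /submoduleP[N0 Nlin] Nx; rewrite -[_ *: _]addr0; exact: Nlin.
Qed.

Lemma submoduleB N x y : submodule N -> N x -> N y -> N (x - y).
Proof.
move=> Nsub Nx Ny; apply: submoduleD => //.
by rewrite -scaleN1r; exact: submoduleZ.
Qed.

Lemma submodule_cyclic x : submodule [set s *: x | s in [set: R]].
Proof.
apply/submoduleP; split; first by exists 0; rewrite ?scale0r.
move=> a _ _ [s _ <-] [t _ <-].
by exists (a * s + t); rewrite // scalerDl scalerA.
Qed.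

Lemma submodule_add E N :
  submodule E -> submodule N -> submodule [set e + n | e in E & n in N].
Proof.
move=> /submoduleP[E0 Elin] /submoduleP[N0 Nlin].
apply/submoduleP; split; first by exists 0 => //; exists 0; rewrite ?addr0.
move=> a _ _ [e Ee [n Nn <-]] [e' Ee' [n' Nn' <-]].
exists (a *: e + e'); first exact: Elin.
exists (a *: n + n'); first exact: Nlin.
by rewrite scalerDr addrACA.
Qed.

Lemma submodule_maximal_avoiding N x :
  submodule N -> ~ N x ->
  exists E, [/\ submodule E, N `<=` E, ~ E x &
    forall E', submodule E' -> E `<=` E' -> ~ E' x -> E' `<=` E].
Proof.
move=> Nsub Nx.
(* The guard lets the empty set in, as [Zorn_bigcup] also quantifies over the
   empty chain. *)
pose P E := E !=set0 -> [/\ submodule E, N `<=` E & ~ E x].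
have [F FP Ftot|E [PE Emax]] := @Zorn_bigcup M P.
  (* The guard provides a point [z] of the union, hence a nonempty member [A] of the chain; it puts
     0 and all of [N] into the union. *)
  case=> z [A FA Az].
  have FPn B y : F B -> B y -> [/\ submodule B, N `<=` B & ~ B x].
    by move=> FB By; apply: (FP B FB); exists y.
  have [/submoduleP[A0 _] NA _] := FPn A z FA Az.
  split; last by case=> B FB Bx; have [_ _] := FPn B x FB Bx.
  - apply/submoduleP; split; first by exists A.
    move=> a y y' [B FB By] [C FC Cy'].
    have [/submoduleP[_ Blin] _ _] := FPn B y FB By.
    have [/submoduleP[_ Clin] _ _] := FPn C y' FC Cy'.
    (* Both vectors lie in the larger of the two members, which is closed under linear
       combinations. *)
    have [BC|CB] := Ftot B C FB FC.
    + by exists C => //; apply: Clin => //; exact: BC.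
    + by exists B => //; apply: Blin => //; exact: CB.
  - by move=> y Ny; exists A => //; exact: NA.
have [N0 _] := (submoduleP N).1 Nsub.
(* The guard alone would allow an empty maximal [E], but [N] satisfies [P] and strictly contains the
   empty set. *)
have [E0|En0] := pselect (E !=set0); last first.
  exfalso; apply: (Emax N); last by move=> _; split.
  split=> [y Ey|NE]; first by case: En0; exists y.
  by apply: En0; exists 0; exact: NE.
have [Esub NE Ex] := PE E0.
exists E; split=> // E' E'sub EE' E'x; apply: contrapT => nE'E.
apply: (Emax E') => // _; split=> //.
exact: subset_trans EE'.
Qed.

Lemma maximal_avoiding_essential E (r : R) x :
  torsion_free M -> submodule E -> r != 0 -> E (r *: x) -> ~ E x ->
  (forall E', submodule E' -> E `<=` E' -> ~ E' x -> E' `<=` E) ->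
  essential E.
Proof.
move=> Mtf Esub r0 Erx Ex Emax N Nsub Nn0 EN0.
have [E0 _] := (submoduleP E).1 Esub.
have [N0 _] := (submoduleP N).1 Nsub.
have EN y : E y -> N y -> y = 0.
  by move=> Ey Ny; suff: (E `&` N) y by rewrite EN0.
have [[e Ee [n Nn xE]]|nENx] := pselect ([set e + n | e in E & n in N] x).
  have rn0 : r *: n = 0.
    apply: EN; last exact: submoduleZ.
    have -> : r *: n = r *: x - r *: e by rewrite -xE scalerDr addrC addKr.
    by apply: submoduleB => //; exact: submoduleZ.
  have [/eqP|n0] := Mtf _ _ rn0; first by rewrite (negbTE r0).
  by apply: Ex; rewrite -xE n0 addr0.
(* Here [E + N] avoids [x], so maximality gives [N] inside [E], and the trivial intersection makes
   [N] zero. *)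
have ENE : [set e + n | e in E & n in N] `<=` E.
  apply: Emax => //; first exact: submodule_add.
  by move=> y Ey; exists y => //; exists 0; rewrite ?addr0.
apply: Nn0; apply/seteqP; split=> [y Ny|_ ->//].
apply: EN => //; apply: ENE.
by exists 0 => //; exists y; rewrite ?add0r.
Qed.

End Submodules.

Lemma not_field_nonunit (R : idomainType) :
  ~ GRing.field_axiom R -> exists2 r : R, r != 0 & r \isn't a GRing.unit.
Proof.
move=> Rnf; apply: contrapT => nr; apply: Rnf => r r0.
by apply: contrapT => /negP ru; apply: nr; exists r.
Qed.

Theorem theorem2p8 (R : idomainType) (R_not_field : ~ GRing.field_axiom R)
    (M : lmodType R) (M_torsion_free : torsion_free M)
    (M_frac : contains_fraction_field M) :
  exists E : set M, proper_essential_submodule E.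
Proof.
have [r r0 rnu] := not_field_nonunit R_not_field.
have [_ _ [f [_ finj _]]] := M_frac.
have {}finj : injective f by move=> p q; apply: finj; exact: mem_set.
(* The type [fracmod R] selects the module structure, so that [r *: q = one] expresses
   [r * (1 / r) = 1]. *)
pose q : fracmod R := (FracField.tofrac r)^-1.
pose one : fracmod R := FracField.tofrac (1 : R).
have rF0 : FracField.tofrac r != 0 by rewrite tofrac_eq0.
have rq : r *: q = one by rewrite /one tofrac1; exact: (@mulfV {fraction R}).
have [|E [Esub uE Ex Emax]] :=
    @submodule_maximal_avoiding R M _ (f q) (submodule_cyclic (f one)).
  (* If [f q = s *: f one], injectivity gives [s / 1 = 1 / r] in the fraction field, so [r * s = 1]
     in [R] and [r] would be a unit. *)
  case=> s _; rewrite -linearZ => /finj sq.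
  have rs1 : r * s = 1.
    apply/eqP; rewrite -tofrac_eq; apply/eqP.
    have sqE : FracField.tofrac s * FracField.tofrac 1 = (FracField.tofrac r)^-1.
      exact: sq.
    by rewrite tofracM -[FracField.tofrac s]mulr1 -tofrac1 sqE mulfV ?tofrac1.
  by move/negP: rnu; apply; apply/unitrPr; exists s.
have Eu : E (f one) by apply: uE; exists 1; rewrite ?scale1r.
exists E; split=> //.
(* [E] contains [f one], which is nonzero since [f] is injective and 1 differs from 0 in the
   fraction field. *)
- move=> E0; move: Eu; rewrite E0 /= -(linear0 f) => /finj /eqP.
  by rewrite /one tofrac1; apply/negP; exact: (@oner_neq0 {fraction R}).
- by move=> ET; apply: Ex; rewrite ET.
- apply: (maximal_avoiding_essential M_torsion_free Esub r0 _ Ex Emax).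
  by rewrite -linearZ rq.
Qed.
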